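(* Let $n,q$ be positive integers, $I\subset\mathbb{R}$ an interval and $f:I\to\mathbf{Q}_q(\mathbb{R}^n)$ a multiple-valued function. If $f$ is affinely approximable on $I$, then $f$ admits a differentiable selection, i.e. there exist differentiable functions $g_1,\dots,g_q:I\to\mathbb{R}^n$ such that $f(x)=\sum_{\alpha=1}^q[\![g_\alpha(x)]\!]$ for all $x\in I$.
   Context: $\mathbf{Q}_q(\mathbb{R}^n)$ is the set of measures $T=\sum_{\alpha=1}^q[\![y_\alpha]\!]$ with $y_1,\dots,y_q\in \mathbb{R}^n$ not necessarily distinct, where $[\![y]\!]$ is the Dirac measure at $y$ (unordered $q$-tuples of points). Its metric is $\mathcal{F}\big(\sum_\alpha[\![y_\alpha]\!],\sum_\alpha[\![z_\alpha]\!]\big)=\min_{\sigma}\sum_{\alpha=1}^q\|y_\alpha-z_{\sigma(\alpha)}\|$, the minimum being over permutations $\sigma$ of $\{1,\dots,q\}$. Intervals (open, closed or half-open) have nonempty interior. $f:I\to\mathbf{Q}_q(\mathbb{R}^n)$ is affinely approximable at $a\in I$ if there exist affine maps $A_1,\dots,A_q:\mathbb{R}\to\mathbb{R}^n$ such that $\lim_{x\to a}|x-a|^{-1}\mathcal{F}\big(f(x),\sum_{\alpha=1}^q[\![A_\alpha(x)]\!]\big)=0$, where the limit is two-sided if $a$ is an interior point of $I$ and one-sided (from inside $I$) if $a$ is an endpoint. $f$ is affinely approximable on $I$ if it is so at every $a\in I$. Differentiability at an endpoint belonging to $I$ means one-sided differentiability.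
   Formalization: Affine approximability at a is taken to include f(a) = Σ[[A_α(a)]]; with the limit alone, which ignores x = a, the claim fails (n = q = 1, f = [[0]] off a, f(a) = [[1]]). *)

(* Defs.v *)
From HB Require Import structures.
From mathcomp Require Import all_boot all_order all_algebra all_fingroup.
From mathcomp Require Import all_classical all_reals all_analysis.

Set Implicit Arguments.
Unset Strict Implicit.
Unset Printing Implicit Defensive.
Import Order.TTheory GRing.Theory Num.Theory.
Import numFieldNormedType.Exports.
Local Open Scope classical_set_scope.
Local Open Scope ring_scope.

(* The library's norm on 'rV[R]_n is the sup norm; this is the Euclidean one. *)
Definition eucl_norm (R : realType) (n : nat) (v : 'rV[R]_n) : R :=
  Num.sqrt (\sum_(i < n) v 0 i ^+ 2).

(* R^n with its Borel sigma-algebra. *)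
Definition borel_rV (R : realType) (n : nat) :=
  g_sigma_algebraType (@open 'rV[R]_n).

Section dirac_sum.
Local Open Scope ereal_scope.
Context (R : realType) (n q : nat) (y : 'I_q -> 'rV[R]_n).

Definition dirac_sum (A : set (borel_rV R n)) : \bar R :=
  \sum_(a < q) dirac (y a : borel_rV R n) A.

Let dirac_sum0 : dirac_sum set0 = 0.
Proof. by rewrite /dirac_sum big1. Qed.

Let dirac_sum_ge0 A : 0 <= dirac_sum A.
Proof. by rewrite /dirac_sum; apply: sume_ge0. Qed.

Let dirac_sum_sigma_additive : semi_sigma_additive dirac_sum.
Proof.
move=> B mB tB mUB; rewrite [X in _ --> X](_ : _ =
    lim ((fun k => \sum_(0 <= i < k) dirac_sum (B i)) @ \oo)).
  by apply: is_cvg_ereal_nneg_natsum => k _; exact: sume_ge0.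
rewrite nneseries_sum//; apply: eq_bigr => /= i _.
exact: measure_semi_bigcup.
Qed.

HB.instance Definition _ := isMeasure.Build _ _ _ dirac_sum
  dirac_sum0 dirac_sum_ge0 dirac_sum_sigma_additive.

End dirac_sum.

(* The set Q_q(R^n) of measures of the form [[y_1]] + ... + [[y_q]]. *)
Definition Qq (R : realType) (n q : nat) : Type :=
  {T : {measure set (borel_rV R n) -> \bar R} |
    exists y : 'I_q -> 'rV[R]_n, T = dirac_sum y}.

Definition Qsum (R : realType) (n q : nat) (y : 'I_q -> 'rV[R]_n) : Qq R n q :=
  exist _ (dirac_sum y : {measure set (borel_rV R n) -> \bar R})
    (ex_intro _ y erefl).

Definition Qpoints (R : realType) (n q : nat) (T : Qq R n q) :
  'I_q -> 'rV[R]_n := sval (cid (svalP T)).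

Definition match_cost (R : realType) (n q : nat) (y z : 'I_q -> 'rV[R]_n)
    (s : 'S_q) : R :=
  \sum_(a < q) eucl_norm (y a - z (s a)).

(* Minimum over all permutations: 'S_q is finite, and the default value of the
   iterated minimum is one of the values over which the minimum is taken. *)
Definition min_match_cost (R : realType) (n q : nat)
    (y z : 'I_q -> 'rV[R]_n) : R :=
  \big[Num.min/match_cost y z 1%g]_(s : 'S_q) match_cost y z s.

(* The choice of the points y, z representing S and T is irrelevant:
   see distQ_Qsum below. *)
Definition distQ (R : realType) (n q : nat) (S T : Qq R n q) : R :=
  min_match_cost (Qpoints S) (Qpoints T).

Definition affine_map (R : realType) (n : nat) (A : R -> 'rV[R]_n) : Prop :=
  exists u v : 'rV[R]_n, forall x, A x = u + x *: v.

(* The filter [within [set` I] a^'] is that of x --> a with x in I, x != a: it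
   is two-sided at interior points of I and one-sided at end points.
   As this filter does not see x = a, the value at a is required separately to
   agree with the approximation; this amounts to
   F(f x, sum_b [[A_b x]]) <= e |x - a| for x in I close to a, x = a included.
   Otherwise f := [[0]] off a, f a := [[v]] with v != 0, would be affinely
   approximable at a. *)
Definition affinely_approximable_at (R : realType) (n q : nat)
    (I : interval R) (f : R -> Qq R n q) (a : R) : Prop :=
  exists A : 'I_q -> R -> 'rV[R]_n,
    [/\ forall b, affine_map (A b),
        f a = Qsum (fun b => A b a) &
        `|x - a|^-1 * distQ (f x) (Qsum (fun b => A b x))
          @[x --> within [set` I] a^'] --> (0 : R)].

Definition affinely_approximable (R : realType) (n q : nat)
    (I : interval R) (f : R -> Qq R n q) : Prop :=
  forall a, a \in I -> affinely_approximable_at I f a.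

(* Differentiability relative to I, hence one-sided at end points. *)
Definition differentiable_on (R : realType) (n : nat)
    (I : interval R) (g : R -> 'rV[R]_n) : Prop :=
  forall a, a \in I ->
    cvg ((x - a)^-1 *: (g x - g a) @[x --> within [set` I] a^']).

Section Qq_theory.
Context (R : realType) (n q : nat).
Implicit Types y z : 'I_q -> 'rV[R]_n.

Lemma QpointsK (T : Qq R n q) : Qsum (Qpoints T) = T.
Proof.
case: T => T HT; apply: eq_exist; rewrite /Qpoints; case: cid => /= y ->.
by [].
Qed.

Lemma dirac_sum1 y (v : 'rV[R]_n) :
  dirac_sum y [set v] = (count_mem v (codom y))%:R%:E.
Proof.
rewrite /dirac_sum codomE count_map -sum1_count natr_sum -sumEFin.
rewrite enumT [RHS]big_mkcond/=; apply: eq_bigr => a _.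
rewrite diracE; case: eqP => [<-|yv]; first by rewrite mem_set.
by rewrite memNset.
Qed.

Lemma Qsum_eqP y z : Qsum y = Qsum z <-> exists s : 'S_q, forall a, y a = z (s a).
Proof.
split=> [/(congr1 sval)/= yz|[s ys]].
  have /tuple_permP[s ts] :
      perm_eq [tuple y i | i < q] [tuple z i | i < q].
    apply/allP => v _ /=; apply/eqP.
    have : dirac_sum y [set v] = dirac_sum z [set v].
      by have /(congr1 (fun m => m [set v])) :=
        congr1 (fun m : {measure set (borel_rV R n) -> \bar R} =>
          m : set _ -> \bar R) yz.
    by rewrite !dirac_sum1 => -[] /(mulrIn (oner_neq0 R)).
  exists s => a.
  have /(congr1 (fun t => nth 0 t a)) := ts.
  by rewrite -!tnth_nth !tnth_mktuple.
apply: eq_exist; apply: eq_measure; apply/funext => A /=.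
rewrite /dirac_sum [RHS](reindex_inj (@perm_inj _ s))/=.
by apply: eq_bigr => a _; rewrite ys.
Qed.

Lemma min_match_cost_le y z s : min_match_cost y z <= match_cost y z s.
Proof. by rewrite /min_match_cost (bigD1 s)//= ge_min lexx. Qed.

Lemma min_match_cost_ex y z : exists s, min_match_cost y z = match_cost y z s.
Proof.
rewrite /min_match_cost; elim/big_ind: _; first by exists 1%g.
  by move=> u v [s ->] [t ->]; case: leP => _; [exists s|exists t].
by move=> s _; exists s.
Qed.

Lemma distQ_Qsum y z : distQ (Qsum y) (Qsum z) = min_match_cost y z.
Proof.
rewrite /distQ; have /esym/Qsum_eqP[s ys] := QpointsK (Qsum y).
have /esym/Qsum_eqP[t zt] := QpointsK (Qsum z).
set y' := Qpoints _ in ys *; set z' := Qpoints _ in zt *.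
have yzE r : match_cost y' z' r = match_cost y z (s * r * t^-1)%g.
  rewrite /match_cost [LHS](reindex_inj (@perm_inj _ s))/=.
  by apply: eq_bigr => a _; rewrite !permM ys zt permKV.
apply/eqP; rewrite eq_le; apply/andP; split.
  have [r ->] := min_match_cost_ex y z.
  have -> : match_cost y z r = match_cost y' z' (s^-1 * r * t)%g.
    by rewrite yzE !mulgA mulgV mul1g mulgK.
  exact: min_match_cost_le.
by have [r ->] := min_match_cost_ex y' z'; rewrite yzE min_match_cost_le.
Qed.

End Qq_theory.

(* Main.v *)
Require Import Defs.
From mathcomp Require Import all_boot all_order all_algebra.
From mathcomp Require Import all_classical all_reals all_analysis.
From mathcomp Require Import fingroup perm lra.
Import Order.TTheory GRing.Theory Num.Theory.
Import numFieldNormedType.Exports.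
Local Open Scope classical_set_scope.
Local Open Scope ring_scope.

(* Strong induction on q.  If the affine maps approximating f at a are not all
   equal, the points of f (x) close to one of them lie, for x near a, in a thin
   cone around its graph that separates them from the others; so f splits near a
   into two affinely approximable functions with fewer points, and has a
   differentiable selection near a by induction.  If they are all equal, every
   selection is differentiable at a.  Two selections on adjacent intervals can be
   glued after a permutation, because the affine approximation at the common end
   point is already determined by f on either side; hence the points having local
   selections fall into intervals, each carrying a selection, and any choice of
   one selection per interval is differentiable everywhere. *)

Section MultivaluedFunctions.
Set Implicit Arguments.
Unset Strict Implicit.

(** * Permutations of finite sequences *)

Section SeqLemmas.

Lemma perm_map_lift (S T : eqType) (h : S -> T) (s : seq S) (t : seq T) :
  perm_eq (map h s) t -> exists2 s', perm_eq s' s & map h s' = t.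
Proof.
case: s => [|x s]; first by rewrite perm_sym => /perm_nilP ->; exists [::].
rewrite perm_sym => /(perm_iotaP (h x))[Is pIs ->].
exists [seq nth x (x :: s) i | i <- Is].
  apply/(perm_iotaP x); exists Is => //.
  by move: pIs; rewrite size_map.
rewrite -map_comp; apply/eq_in_map => i iIs /=.
rewrite -(nth_map _ (h x)) //.
by move: iIs; rewrite (perm_mem pIs) mem_iota size_map.
Qed.

(** The last clause says that [sg] permutes the indices below [q], in the form used to relabel a
    selection. *)
Lemma perm_mkseq_reindex (T : eqType) (P Q : nat -> T) (q : nat) :
  perm_eq (mkseq P q) (mkseq Q q) ->
  exists sg : nat -> nat, [/\ forall i, (i < q)%N -> (sg i < q)%N,
    forall i, (i < q)%N -> P i = Q (sg i) &
    forall (S : eqType) (F : nat -> S),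
      perm_eq (mkseq (F \o sg) q) (mkseq F q)].
Proof.
rewrite perm_sym => /perm_map_lift[Is pIs PQ].
have sz : size Is = q by rewrite (perm_size pIs) size_iota.
rewrite perm_sym in pIs.
have sgE i : (i < q)%N -> nth 0%N Is i \in iota 0 q.
  by move=> iq; rewrite (perm_mem pIs) mem_nth ?sz.
exists (nth 0%N Is); split=> [i /sgE|i iq|S F]; first by rewrite mem_iota.
  by rewrite -(nth_mkseq (P 0%N) P iq) -PQ (nth_map 0%N) ?sz.
rewrite /mkseq map_comp map_nth_iota0 ?sz // -{1}sz take_size.
by apply: perm_map; rewrite perm_sym.
Qed.

End SeqLemmas.

(** * Affine approximation of multisets, and its uniqueness *)

Section AffineApprox.
Context (R : realType) (V : normedModType R).
Implicit Types (p : V * V) (a x e : R) (J K : set R) (f : R -> seq V).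
Implicit Types (As Bs : seq (V * V)).

(** An affine map is coded by its value at the base point [a] and its slope, so that equality of
    maps is equality of pairs. *)
Definition aff p a x : V := p.1 + (x - a) *: p.2.

Lemma aff_base p a : aff p a a = p.1.
Proof. by rewrite /aff subrr scale0r addr0. Qed.

(** If the values at [a] differ, the gap does not tend to 0 and beats any multiple of [|x - a|] near
    [a]; if only the slopes differ, the gap is [|x - a|] times their distance, and half of that
    distance serves as [c]. *)
Lemma aff_inj p p' a : exists2 c : R, 0 < c &
  \forall x \near a, x != a ->
    `|aff p a x - aff p' a x| <= c * `|x - a| -> p = p'.
Proof.
have [<-|pp'] := eqVneq p p'; first by exists 1 => //; near=> x.
have affB x : aff p a x - aff p' a x =
    (p.1 - p'.1) + (x - a) *: (p.2 - p'.2).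
  by rewrite /aff opprD addrACA scalerBr.
have [p1|p1] := eqVneq p.1 p'.1.
  have N0 : 0 < `|p.2 - p'.2|.
    rewrite normr_gt0 subr_eq0; apply: contra pp' => /eqP p2.
    by case: p p' p1 p2 {affB} => ? ? [? ?] /= -> ->.
  exists (`|p.2 - p'.2| / 2); first by rewrite divr_gt0.
  near=> x => xa; rewrite affB p1 subrr add0r normrZ mulrC.
  by rewrite ler_pM2r ?normr_gt0 ?subr_eq0 // => le; exfalso; clear p1; lra.
have D0 : 0 < `|p.1 - p'.1| by rewrite normr_gt0 subr_eq0.
set N := `|p.2 - p'.2|.
have N1 : 0 < N + 1 by rewrite ltr_wpDl // normr_ge0.
exists 1 => //; near=> x => xa; rewrite affB mul1r => le.
have : `|p.1 - p'.1| <= `|x - a| + `|x - a| * N.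
  rewrite /N -normrZ -{1}(addrK ((x - a) *: (p.2 - p'.2)) (p.1 - p'.1)).
  by rewrite (le_trans (ler_normB _ _)) // lerD2r.
suff : `|x - a| * (N + 1) < `|p.1 - p'.1|.
  by rewrite mulrDr mulr1 => ? ?; exfalso; lra.
rewrite -ltr_pdivlMr // distrC.
near: x; apply: nbhsx_ballx.
by rewrite divr_gt0.
Unshelve. all: by end_near. Qed.

Lemma aff_inj_seq (s : seq ((V * V) * (V * V))) a : exists2 c : R, 0 < c &
  \forall x \near a, x != a -> forall pp, pp \in s ->
    `|aff pp.1 a x - aff pp.2 a x| <= c * `|x - a| -> pp.1 = pp.2.
Proof.
elim: s => [|pp s [c c0 IH]]; first by exists 1 => //; near=> x.
have [d d0 H] := aff_inj pp.1 pp.2 a.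
exists (Num.min c d); first by rewrite lt_min c0 d0.
apply: filterS2 IH H => x H1 H2 xa pp'.
rewrite in_cons => /orP[/eqP -> /le_trans H|pp's /le_trans H].
  by apply: H2 => //; apply: H; rewrite ler_wpM2r // ge_min lexx orbT.
by apply: H1 => //; apply: H; rewrite ler_wpM2r // ge_min lexx.
Unshelve. all: by end_near. Qed.

Lemma aff_inj_seq2 As Bs a : exists2 c : R, 0 < c &
  \forall x \near a, x != a -> forall p p', p \in As -> p' \in Bs ->
    `|aff p a x - aff p' a x| <= c * `|x - a| -> p = p'.
Proof.
have [c c0 H] := aff_inj_seq [seq (p, p') | p <- As, p' <- Bs] a.
exists c => //; apply: filterS H => x H xa p p' pA p'B.
by apply: (H xa (p, p')); apply/allpairsP; exists (p, p').
Qed.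

(* The pairs in [w] realise a bijection between the points of [s] and those of
   [As]. *)
Definition matched (s : seq V) As a x e : Prop :=
  exists w : seq (V * (V * V)), [/\ perm_eq (unzip1 w) s, perm_eq (unzip2 w) As
    & forall zp, zp \in w -> `|zp.1 - aff zp.2 a x| <= e * `|x - a|].

(** The point [x = a] is included, with error bound 0; hence, if [J a], the values of [As] at [a]
    must be the points of [f a]. *)
Definition affine_approx J f a As : Prop :=
  forall e, 0 < e -> \forall x \near a, J x -> matched (f x) As a x e.

Lemma matched_base s As a e : matched s As a a e ->
  perm_eq s (unzip1 As).
Proof.
move=> [w [p1 p2 H]]; rewrite -(permPl p1).
apply: perm_trans (perm_map _ p2).
suff -> : unzip1 w = unzip1 (unzip2 w) by [].
rewrite /unzip1 -map_comp; apply/eq_in_map => zp /H /=.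
by rewrite subrr normr0 mulr0 normr_le0 subr_eq0 aff_base => /eqP.
Qed.

Lemma base_matched s As a e : perm_eq s (unzip1 As) -> matched s As a a e.
Proof.
rewrite perm_sym => p; exists [seq (p.1, p) | p <- As]; split.
- by rewrite /unzip1 -map_comp.
- by rewrite /unzip2 -map_comp map_id.
- by move=> _ /mapP[p' _ ->]; rewrite aff_base !subrr !normr0 mulr0.
Qed.

Lemma affine_approx_base J f a As : J a -> affine_approx J f a As ->
  perm_eq (f a) (unzip1 As).
Proof. by move=> Ja /(_ 1 ltr01)/nbhs_singleton/(_ Ja)/matched_base. Qed.

Lemma affine_approxS J K f a As : K `<=` J ->
  affine_approx J f a As -> affine_approx K f a As.
Proof.
by move=> KJ H e e0; apply: filterS (H e e0) => x Hx /KJ.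
Qed.

(* Near [a], distinct affine maps differ by more than a multiple of [|x - a|],
   so a fine enough matching of two affine approximations is an identity. *)
Lemma affine_approx_unique J f a As Bs :
  (forall e, 0 < e -> exists x, [/\ J x, x != a & `|x - a| < e]) ->
  affine_approx J f a As -> affine_approx J f a Bs -> perm_eq As Bs.
Proof.
move=> acc HA HB; have [c c0 Hc] := aff_inj_seq2 As Bs a.
(* Two matching errors of [c / 2] add up to the gap constant [c]. *)
have c20 : 0 < c / 2 by rewrite divr_gt0.
have [/= d d0 H] : \forall x \near a, [/\ J x -> matched (f x) As a x (c / 2),
    J x -> matched (f x) Bs a x (c / 2) &
    x != a -> forall p p', p \in As -> p' \in Bs ->
    `|aff p a x - aff p' a x| <= c * `|x - a| -> p = p'].
  by apply: filterS3 (HA _ c20) (HB _ c20) Hc => x *; split.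
have [x [Jx xa xd]] := acc d d0.
have /H[/(_ Jx)[w [w1 w2 Hw]] /(_ Jx)[u [u1 u2 Hu]] inj] : ball_ Num.norm a d x.
  by rewrite /= distrC.
(* Reordered as [w'], the matching [w] lists the points of [f x] in the same order as [u]; two maps
   paired with the same point are then too close to be distinct. *)
have /perm_map_lift[w' pw' ew'] : perm_eq (unzip1 w) (unzip1 u).
  by rewrite (permPl w1) perm_sym.
have p2 : perm_eq (unzip2 w') (unzip2 w) := perm_map snd pw'.
rewrite -(permPl w2) -(permPl p2) -(permPr u2).
suff -> : unzip2 w' = unzip2 u by [].
have sz : size w' = size u by have := congr1 size ew'; rewrite !size_map.
apply: (@eq_from_nth _ (0, 0)); rewrite !size_map // => i iw.
pose z0 : V * (V * V) := (0, (0, 0)).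
rewrite !(nth_map z0) // -?sz //.
set y := nth z0 w' i; set z := nth z0 u i.
have yw : y \in w by rewrite -(perm_mem pw') mem_nth.
have zu : z \in u by rewrite mem_nth // -sz.
have yz : y.1 = z.1 by rewrite -!(nth_map _ 0 fst) -?sz //; congr nth.
apply: (inj xa).
- by rewrite -(perm_mem w2); apply: map_f.
- by rewrite -(perm_mem u2); apply: map_f.
have := Hw _ yw; have := Hu _ zu; rewrite -yz => h1.
rewrite distrC => h2.
have -> : aff y.2 a x - aff z.2 a x =
   (aff y.2 a x - y.1) + (y.1 - aff z.2 a x) by rewrite addrA subrK.
by rewrite (le_trans (ler_normD _ _)) //; lra.
Qed.

End AffineApprox.

(** * Differentiable selections: gluing, and exhaustion of an interval *)

Section Selection.
Context (R : realType) (V : normedModType R).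
Implicit Types (p : V * V) (a c x e : R) (J K : set R) (f : R -> seq V).
Implicit Types (As Bs : seq (V * V)) (u v : V) (q i : nat) (g h : nat -> R -> V).

(** Without a quotient, [x = a] needs no exception; if [a] is isolated in [J], every [v]
    qualifies. *)
Definition deriv_on J (u : R -> V) a v : Prop :=
  forall e, 0 < e -> \forall x \near a, J x ->
    `|u x - aff (u a, v) a x| <= e * `|x - a|.

Lemma deriv_on_local J J' (u u' : R -> V) a v : J a ->
  (\forall x \near a, J x -> J' x /\ u x = u' x) ->
  deriv_on J' u' a v -> deriv_on J u a v.
Proof.
move=> Ja uu' H e e0; have [_ ea] := nbhs_singleton uu' Ja.
apply: filterS2 uu' (H e e0) => x uu' {}H Jx; have [J'x ->] := uu' Jx.
by rewrite ea; apply: H.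
Qed.

Definition selection q g f J : Prop :=
  (forall x, J x -> perm_eq (f x) (mkseq (g^~ x) q)) /\
  (forall i, (i < q)%N -> forall a, J a -> exists v, deriv_on J (g i) a v).

Lemma selectionS q g f J K : K `<=` J -> selection q g f J -> selection q g f K.
Proof.
move=> KJ [H1 H2]; split=> [x /KJ/H1 //|i iq a Ka].
have [v Hv] := H2 i iq a (KJ _ Ka); exists v.
apply: deriv_on_local Hv => //; near=> x => Kx; split=> //; exact: KJ.
Unshelve. all: by end_near. Qed.

(** With [affine_approx_unique], this identifies the values and slopes of a selection at [a] with
    any given approximation, up to order. *)
Lemma selection_affine_approx q g f J a (v : nat -> V) :
  (forall x, J x -> perm_eq (f x) (mkseq (g^~ x) q)) ->
  (forall i, (i < q)%N -> deriv_on J (g i) a (v i)) ->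
  affine_approx J f a (mkseq (fun i => (g i a, v i)) q).
Proof.
move=> H Hv e e0.
have near_g : \forall x \near a, forall i : 'I_q, J x ->
    `|g i x - aff (g i a, v i) a x| <= e * `|x - a|.
  apply: (@filter_forall _ _ (fun (i : 'I_q) x => J x ->
    `|g i x - aff (g i a, v i) a x| <= e * `|x - a|) (nbhs a)) => i.
  exact: Hv.
apply: filterS near_g => x Hx Jx.
exists (mkseq (fun i => (g i x, (g i a, v i))) q); split.
- by rewrite /mkseq /unzip1 -map_comp perm_sym; apply: H.
- by rewrite /mkseq /unzip2 -map_comp.
- by move=> zp /mapP[i]; rewrite mem_iota => /= iq ->; apply: (Hx (Ordinal iq)).
Qed.

Lemma is_interval_accumulation K c y e : is_interval K -> K c -> K y -> y != c ->
  0 < e -> exists x, [/\ K x, x != c & `|x - c| < e].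
Proof.
move=> iK Kc Ky; rewrite neq_lt => /orP[yc|cy] e0.
  have [ye|ye] := leP y (c - e / 2).
    exists (c - e / 2); split; last by rewrite addrC addKr normrN gtr0_norm; lra.
      by apply: (iK y c) => //; lra.
    by rewrite lt_eqF //; lra.
  by exists y; rewrite lt_eqF //; split=> //; rewrite ltr0_norm; lra.
have [ye|ye] := leP (c + e / 2) y.
  exists (c + e / 2); split; last by rewrite addrC addKr gtr0_norm; lra.
    by apply: (iK c y) => //; lra.
  by rewrite gt_eqF //; lra.
by exists y; rewrite gt_eqF //; split=> //; rewrite gtr0_norm; lra.
Qed.

Lemma is_intervalI K J : is_interval K -> is_interval J -> is_interval (K `&` J).
Proof.
move=> iK iJ x y [Kx Jx] [Ky Jy] z xzy.
by split; [apply: (iK x y)|apply: (iJ x y)].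
Qed.

Lemma is_interval_le c : is_interval [set x : R | x <= c].
Proof. by move=> x y /= xc yc z /andP[_ /le_trans]; apply. Qed.

Lemma is_interval_ge c : is_interval [set x : R | c <= x].
Proof. by move=> x y /= xc yc z /andP[/(le_trans xc)]. Qed.

(** By uniqueness on either side, the values and slopes of [g] and of [h] at [c] are both
    permutations of [As]; relabelling [h] makes them agree. That [k] extends [g] to the left of [c]
    allows iteration. *)
Lemma selection_glue q g h f K c As :
  is_interval K -> K c -> affine_approx K f c As ->
  selection q g f (K `&` [set x | x <= c]) ->
  selection q h f (K `&` [set x | c <= x]) ->
  exists2 k, selection q k f K &
    forall i x, (i < q)%N -> K x -> x < c -> k i x = g i x.
Proof.
move=> iK Kc HA Hg Hh.
(* Uniqueness on one side requires points of [K] there; if there are none, the selection on the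
   other side already covers [K]. *)
have [[yl [Kyl ylc]]|noL] := pselect (exists y, K y /\ y < c); last first.
  exists h => [|i x _ Kx xc]; last by case: noL; exists x.
  apply: selectionS Hh => x Kx; split=> //=; rewrite leNgt; apply/negP => xc.
  by apply: noL; exists x.
have [[yr [Kyr cyr]]|noR] := pselect (exists y, K y /\ c < y); last first.
  exists g => //.
  apply: selectionS Hg => x Kx; split=> //=; rewrite leNgt; apply/negP => xc.
  by apply: noR; exists x.
move: Hg Hh => [Hg1 Hg2] [Hh1 Hh2].
set L := K `&` [set x | x <= c] in Hg1 Hg2 *.
set M := K `&` [set x | c <= x] in Hh1 Hh2 *.
have Lc : L c by split=> /=.
have Mc : M c by split=> /=.
have /choice[v Hv] i : exists v, (i < q)%N -> deriv_on L (g i) c v.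
  by case: ltnP => [iq|_]; [have [v ?] := Hg2 i iq c Lc; exists v|exists 0].
have /choice[w Hw] i : exists v, (i < q)%N -> deriv_on M (h i) c v.
  by case: ltnP => [iq|_]; [have [w ?] := Hh2 i iq c Mc; exists w|exists 0].
have HL : affine_approx L f c As by apply: affine_approxS HA => x [].
have HM : affine_approx M f c As by apply: affine_approxS HA => x [].
have pL := affine_approx_unique _ (selection_affine_approx Hg1 Hv) HL.
have pM := affine_approx_unique _ (selection_affine_approx Hh1 Hw) HM.
(* [sg] pairs branches with the same value and the same slope at [c]. *)
have [|sg [sgq sgE sgP]] := @perm_mkseq_reindex _ (fun i => (g i c, v i))
    (fun i => (h i c, w i)) q.
  rewrite (permPl (pL _)) ?(permPr (pM _)) //.
  - move=> e; apply: (@is_interval_accumulation _ _ yr) => //.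
    + exact: is_intervalI iK (@is_interval_ge c).
    + by split=> //=; apply: ltW.
    + by rewrite gt_eqF.
  - move=> e; apply: (@is_interval_accumulation _ _ yl) => //.
    + exact: is_intervalI iK (@is_interval_le c).
    + by split=> //=; apply: ltW.
    + by rewrite lt_eqF.
exists (fun i x => if x <= c then g i x else h (sg i) x); last first.
  by move=> i x iq Kx /ltW ->.
split=> [x Kx|i iq a Ka].
  have [xc|cx] := leP x c; first by apply: Hg1.
  apply: perm_trans (Hh1 x _) _; first by split=> //=; apply: ltW.
  by rewrite perm_sym; apply: (sgP _ (h^~ x)).
have sgq' := sgq _ iq.
have [ac|ca|->] := ltgtP a c.
- have La : L a by split=> //=; apply: ltW.
  have [v' Hv'] := Hg2 i iq a La; exists v'.
  apply: deriv_on_local Hv' => //.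
  near=> x => Kx; have xc : x < c by near: x; exact: lt_nbhsl.
  by rewrite (ltW xc); split=> //; split=> //=; apply: ltW.
- have Ma : M a by split=> //=; apply: ltW.
  have [v' Hv'] := Hh2 (sg i) sgq' a Ma; exists v'.
  apply: deriv_on_local Hv' => //.
  near=> x => Kx; have xc : c < x by near: x; exact: lt_nbhsr.
  by rewrite leNgt xc; split=> //; split=> //=; apply: ltW.
- exists (v i) => e e0; have [gh vw] := sgE _ iq.
  have := Hw _ sgq' e e0; apply: filterS2 (Hv _ iq e e0) => x Hgx Hhx Kx.
  rewrite lexx; have [xc|cx] := leP x c; first by apply: Hgx.
  by rewrite gh vw; apply: Hhx; split=> //=; apply: ltW.
Unshelve. all: by end_near. Qed.

(** Selections up to the members of a cofinal sequence are glued one after another; each stage keeps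
    the previous one to the left of its end, so the stages have a limit. *)
Lemma selection_exhaust q f K : is_interval K ->
  (forall c, K c -> exists As, affine_approx K f c As) ->
  (forall c, K c -> exists g, selection q g f (K `&` [set x | x <= c])) ->
  exists g, selection q g f K.
Proof.
move=> iK HA Hsel.
have [[m [Km mmax]]|nomax] := pselect (exists m, K m /\ forall x, K x -> x <= m).
  have [g Hg] := Hsel m Km; exists g; apply: selectionS Hg => x Kx.
  by split=> //=; apply: mmax.
have gtK x : K x -> exists2 y, K y & x < y.
  move=> Kx; apply: contrapT => H; apply: nomax; exists x; split=> // y Ky.
  by rewrite leNgt; apply/negP => xy; apply: H; exists y.
have [[x0 Kx0]|K0] := pselect (exists x, K x); last first.
  by exists (fun _ _ => 0); split=> [x Kx|i iq x Kx]; case: K0; exists x.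
(* [u] enumerates the rationals in [K], with [x0] in place of those outside; it is cofinal by
   density, as [K] has no maximum. *)
have [u Hu] : exists u : nat -> R, (forall k, K (u k)) /\
    forall x, K x -> exists k, x < u k.
  pose r k : R := ratr (odflt 0 (unpickle k)).
  exists (fun k => if pselect (K (r k)) then r k else x0); split.
    by move=> k; case: pselect.
  move=> x Kx; have [y Ky xy] := gtK x Kx.
  have [s /itvP sxy] := rat_in_itvoo xy.
  have rs : r (pickle s) = ratr s by rewrite /r pickleK.
  exists (pickle s); rewrite rs; case: pselect => [?|nK]; first by rewrite sxy.
  by case: nK; apply: (iK x y) => //; rewrite !sxy.
case: Hu => uK ucof.
pose st := {tg : R * (nat -> R -> V) |
  K tg.1 /\ selection q tg.2 f (K `&` [set x | x <= tg.1])}.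
have [g0 Hg0] := Hsel x0 Kx0.
have step (ks : nat * st) : exists s : st,
    [/\ (sval ks.2).1 <= (sval s).1, u ks.1 <= (sval s).1 &
     forall i x, (i < q)%N -> K x -> x < (sval ks.2).1 ->
       (sval s).2 i x = (sval ks.2).2 i x].
  case: ks => k [[t g] /= [Kt Hg]].
  have [tu|ut] := ltP t (u k); last first.
    have tg : K (t, g).1 /\ selection q (t, g).2 f (K `&` [set x | x <= (t, g).1]).
      by [].
    by exists (exist _ (t, g) tg).
  have [h Hh] := Hsel _ (uK k).
  have [As HAs] := HA t Kt.
  have iK' := is_intervalI iK (@is_interval_le (u k)).
  have [||||k' Hk' Ek'] :=
      @selection_glue q g h f (K `&` [set x | x <= u k]) t As iK'.
  - by split=> //=; apply: ltW.
  - by apply: affine_approxS HAs => x [].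
  - by apply: selectionS Hg => x [[Kx _] xt]; split.
  - by apply: selectionS Hh => x [].
  have tg : K (u k, k').1 /\
      selection q (u k, k').2 f (K `&` [set x | x <= (u k, k').1]).
    by split=> //; apply: uK.
  exists (exist _ (u k, k') tg); split=> //=; first exact: ltW.
  move=> i x iq Kx xt; apply: Ek' => //; split=> //=.
  exact: le_trans (ltW xt) (ltW tu).
have [nxt Hnxt] := choice step.
pose s0 : st := exist _ (x0, g0) (conj Kx0 Hg0).
pose s := fix s k := if k is k'.+1 then nxt (k', s k') else s0.
pose t k := (sval (s k)).1; pose h k := (sval (s k)).2.
have t_le k l : (k <= l)%N -> t k <= t l.
  move=> /subnK <-; elim: (l - k)%N => // d IH.
  apply: le_trans IH _; rewrite addSn.
  by have [] := Hnxt ((d + k)%N, s (d + k)%N).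
have h_eq k l i x : (k <= l)%N -> (i < q)%N -> K x -> x < t k -> h l i x = h k i x.
  move=> /subnK <-; elim: (l - k)%N => // d IH iq Kx xt.
  rewrite -(IH iq Kx xt) addSn.
  have [_ _] := Hnxt ((d + k)%N, s (d + k)%N); apply => //.
  exact: lt_le_trans xt (t_le _ _ (leq_addl _ _)).
(* The inequality is strict because a stage is preserved only strictly left of its end, and because
   all of [K] near [x] then lies in one stage. *)
have tcof x : exists k, K x -> x < t k.
  have [Kx|nKx] := pselect (K x); last by exists 0%N.
  have [k xk] := ucof x Kx; exists k.+1 => _.
  by apply: lt_le_trans xk _; have [] := Hnxt (k, s k).
have [kap Hkap] := choice tcof.
have gE k i x : (i < q)%N -> K x -> x < t k -> h (kap x) i x = h k i x.
  move=> iq Kx xt; have [kk|/ltnW kk] := leqP k (kap x); first exact: h_eq.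
  by symmetry; apply: h_eq => //; apply: Hkap.
exists (fun i x => h (kap x) i x).
have selh k : selection q (h k) f (K `&` [set x | x <= t k]).
  by rewrite /h /t; case: (s k) => ? [].
split=> [x Kx|i iq a Ka].
  have [+ _] := selh (kap x); apply; split=> //=; apply: ltW; exact: Hkap.
have at_ := Hkap a Ka; have [_ /(_ i iq a)[|v Hv]] := selh (kap a).
  by split=> //=; apply: ltW.
exists v; apply: deriv_on_local Hv => //.
near=> x => Kx; have xt : x < t (kap a) by near: x; exact: lt_nbhsl.
by split; [split=> //=; apply: ltW|exact: gE].
Unshelve. all: by end_near. Qed.

End Selection.

(** * Reflection of the line, to exhaust an interval towards the left *)

Section Reflection.
Context (R : realType) (V : normedModType R).
Implicit Types (a c x : R) (J K : set R) (f : R -> seq V) (q : nat).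

Lemma aff_opp (u v : V) a x : aff (u, - v) (- a) x = aff (u, v) a (- x).
Proof. by rewrite /aff /= scalerN -scaleNr opprB [- a - x]addrC. Qed.

Lemma distr_opp a x : `|x - - a| = `|- x - a|.
Proof. by rewrite -normrN opprB addrC. Qed.

Lemma affine_approx_opp J f a (As : seq (V * V)) : affine_approx J f a As ->
  affine_approx [set x | J (- x)] (f \o -%R) (- a) [seq (p.1, - p.2) | p <- As].
Proof.
move=> HA e e0; apply/nearN; apply: filterS (HA e e0) => x /= Hx.
rewrite opprK => /Hx[w [w1 w2 Hw]].
exists [seq (zp.1, (zp.2.1, - zp.2.2)) | zp <- w]; split.
- by rewrite /unzip1 -map_comp.
- rewrite /unzip2 -map_comp; apply: perm_trans (perm_map _ w2).
  by rewrite /unzip2 -map_comp.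
- move=> _ /mapP[[z [u v]] zpw ->]; rewrite aff_opp distr_opp opprK.
  exact: (Hw _ zpw).
Qed.

Lemma selection_opp q g f J : selection q g f J ->
  selection q (fun i => g i \o -%R) (f \o -%R) [set x | J (- x)].
Proof.
move=> [H1 H2]; split=> [x /H1 //|i iq a]; rewrite -[a]opprK.
move: (- a) => {}a /=; rewrite opprK => Ja.
have [v Hv] := H2 i iq _ Ja; exists (- v) => e e0.
apply/nearN; apply: filterS (Hv e e0) => x Hx /=; rewrite !opprK => /Hx.
by rewrite aff_opp !opprK [- x + a]addrC (distrC x).
Qed.

Lemma selection_exhaust_left q f K : is_interval K ->
  (forall c, K c -> exists As, affine_approx K f c As) ->
  (forall c, K c -> exists g, selection q g f (K `&` [set x | c <= x])) ->
  exists g, selection q g f K.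
Proof.
move=> iK HA Hsel.
have [|c Kc|c Kc|g /selection_opp] :=
    @selection_exhaust _ _ q (f \o -%R) [set x | K (- x)].
- move=> x y Kx Ky z /andP[xz zy]; apply: (iK _ _ Ky Kx).
  by rewrite !lerN2 xz zy.
- have [As /affine_approx_opp] := HA _ Kc; rewrite opprK => ?.
  by exists [seq (p.1, - p.2) | p <- As].
- have [g /selection_opp Hg] := Hsel _ Kc; exists (fun i => g i \o -%R).
  by apply: selectionS Hg => x [/= Kx xc]; split=> //=; rewrite lerN2.
have -> : (f \o -%R) \o -%R = f by apply/funext => x /=; rewrite opprK.
move=> Hg; exists (fun i => g i \o -%R); apply: selectionS Hg => x /=.
by rewrite opprK.
Qed.

End Reflection.

(** * Maximal intervals carrying a selection *)

Section Patching.
Context (R : realType) (V : normedModType R).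
Implicit Types (a c x : R) (J K : set R) (f : R -> seq V) (q : nat).

(** Every point of [f x] is matched with the same [p], so the estimate holds whichever points [u]
    picks. *)
Lemma deriv_on_const_approx q f J a (p : V * V) (u : R -> V) :
  J a -> affine_approx J f a (nseq q p) -> (forall x, J x -> u x \in f x) ->
  deriv_on J u a p.2.
Proof.
move=> Ja HA uf.
have uap : (u a, p.2) = p.
  have /perm_mem/(_ (u a)) := affine_approx_base Ja HA.
  by rewrite uf // /unzip1 map_nseq mem_nseq => /esym/andP[_ /eqP ->]; case: (p).
rewrite /deriv_on uap => e e0; apply: filterS (HA e e0) => x Hx Jx.
have [w [w1 w2 Hw]] := Hx Jx.
have := uf x Jx; rewrite -(perm_mem w1) => /mapP[zp zpw ->].
have : zp.2 \in nseq q p by rewrite -(perm_mem w2) map_f.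
by rewrite mem_nseq => /andP[_ /eqP <-]; apply: Hw.
Qed.

Definition between (x y : R) : set R :=
  [set z | Num.min x y <= z <= Num.max x y].

Lemma is_interval_between x y : is_interval (between x y).
Proof.
move=> u v /= /andP[ul _] /andP[_ vr] z /andP[uz zv].
by rewrite /between /= (le_trans ul uz) (le_trans zv vr).
Qed.

Lemma betweenC x y : between x y = between y x.
Proof. by rewrite /between minC maxC. Qed.

Lemma between_le x y : x <= y -> between x y = [set z | x <= z <= y].
Proof. by move=> xy; rewrite /between min_l // max_r. Qed.

Section Classes.
Variables (q : nat) (f : R -> seq V) (J : set R).
Hypothesis iJ : is_interval J.
Hypothesis HA : forall c, J c -> exists As, affine_approx J f c As.
Hypothesis Hsz : forall c, J c -> size (f c) = q.

Let linked x y := exists g, selection q g f (J `&` between x y).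

Let linkedC x y : linked x y -> linked y x.
Proof. by rewrite /linked betweenC. Qed.

Let linked_refl x : J x -> linked x x.
Proof.
move=> Jx; have eqx y : (J `&` between x x) y -> y = x.
  by move=> [_]; rewrite between_le //= => yx; apply/le_anti; rewrite andbC.
exists (fun i _ => nth 0 (f x) i); split=> [y /eqx ->|i iq y /eqx ->].
  by rewrite -(Hsz Jx) mkseq_nth.
(* On a one-point domain any slope is a derivative. *)
exists 0 => e e0; near=> z => /eqx ->.
by rewrite aff_base !subrr !normr0 mulr0.
Unshelve. all: by end_near. Qed.

Let linked_sub x y u v : (between u v `<=` between x y) -> linked x y -> linked u v.
Proof.
move=> sub [g Hg]; exists g; apply: selectionS Hg => z [Jz /sub ?].
by split.
Qed.

(** If [y] is not between [x] and [z], one of the given intervals contains the whole of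
    [between x z]; otherwise the two selections are glued at [y]. *)
Let linked_trans x y z : J y -> linked x y -> linked y z -> linked x z.
Proof.
move=> Jy; wlog xz : x z / x <= z.
  move=> H; have [xz|/ltW zx] := leP x z; first exact: H.
  by move=> /linkedC lyx /linkedC lzy; apply: linkedC; apply: H.
move=> lxy lyz; have [xy|yx] := leP x y; last first.
  apply: linked_sub lyz; rewrite !between_le //; last first.
    exact: le_trans (ltW yx) xz.
  by move=> w /= /andP[/(le_trans (ltW yx)) -> ->].
have [yz|zy] := leP y z; last first.
  apply: linked_sub lxy; rewrite !between_le //.
  by move=> w /= /andP[-> /le_trans ->] //; apply: ltW.
have [As HAs] := HA Jy; have [g Hg] := lxy; have [h Hh] := lyz.
have [|||||k Hk _] := @selection_glue _ _ q g h f (J `&` between x z) y As.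
- exact: is_intervalI iJ (@is_interval_between x z).
- by split=> //; rewrite between_le //= xy.
- by apply: affine_approxS HAs => w [].
- apply: selectionS Hg => w [[Jw]]; rewrite !between_le //= => /andP[xw _] wy.
  by rewrite xw.
- apply: selectionS Hh => w [[Jw]]; rewrite !between_le //= => /andP[_ wz] yw.
  by rewrite yw.
by exists k.
Qed.

Let linked_class x := [set y | J y /\ linked x y].

(** Any two members of the class have a selection between them. Exhausting to the left of a fixed
    member [t] gives a selection up to [t]; exhausting to the right then covers the class. *)
Let linked_class_selection x : J x -> exists g, selection q g f (linked_class x).
Proof.
move=> Jx; set C := linked_class x.
have CJ : C `<=` J by move=> y [].
have HAC K : K `<=` C -> forall c, K c -> exists As, affine_approx K f c As.
  move=> KC c /KC/CJ/HA[As HAs]; exists As; apply: affine_approxS HAs.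
  exact: subset_trans KC CJ.
have linkC y z : C y -> C z -> linked y z.
  by move=> [Jy xy] [Jz xz]; apply: linked_trans (linkedC xy) xz.
have iC : is_interval C.
  move=> y z Cy Cz w ywz; have Jw : J w by apply: (iJ (CJ _ Cy) (CJ _ Cz)).
  split=> //; have [Jy xy] := Cy; apply: linked_trans xy _ => //.
  apply: linked_sub (linkC _ _ Cy Cz).
  have /andP[yw wz] := ywz; rewrite !between_le //; last exact: le_trans wz.
  by move=> u /= /andP[-> /le_trans ->].
apply: selection_exhaust => //; first exact: HAC.
move=> t Ct; apply: selection_exhaust_left.
- exact: is_intervalI iC (@is_interval_le _ t).
- by apply: HAC => y [].
move=> s [Cs /= st]; have [g Hg] := linkC _ _ Cs Ct; exists g.
apply: selectionS Hg => y [[[Jy _] /= yt] /= sy]; split=> //.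
by rewrite between_le //= sy.
Qed.

(* The linked classes are the maximal intervals carrying a selection; at a point
   whose affine approximation is a single map any selection is differentiable,
   so the selections chosen on the classes need not match there. *)
Lemma selection_patch :
  (forall a, J a -> (exists p, affine_approx J f a (nseq q p)) \/
    exists2 e : R, 0 < e &
      exists g, selection q g f (J `&` [set x | `|x - a| < e])) ->
  exists g, selection q g f J.
Proof.
move=> Hloc.
(* [S] depends on the set alone, so points with the same class receive the same selection. *)
have /choice[S HS] (K : set R) : exists g,
    (exists g', selection q g' f K) -> selection q g f K.
  have [[g Hg]|no] := pselect (exists g', selection q g' f K).
    by exists g.
  by exists (fun _ _ => 0) => /no.
have HSC a : J a -> selection q (S (linked_class a)) f (linked_class a).
  by move=> /linked_class_selection/HS.
have Cxx a : J a -> linked_class a a by move=> Ja; split=> //; apply: linked_refl.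
pose g i x := S (linked_class x) i x.
have fg x : J x -> perm_eq (f x) (mkseq (g^~ x) q).
  by move=> Jx; have [+ _] := HSC x Jx; apply; apply: Cxx.
exists g; split=> // i iq a Ja.
have [[p HAp]|[e e0 [h Hh]]] := Hloc a Ja.
  exists p.2; apply: deriv_on_const_approx HAp _ => // x Jx.
  by rewrite (perm_mem (fg x Jx)); apply/mapP; exists i; rewrite ?mem_iota.
have [_ /(_ i iq a (Cxx _ Ja))[v Hv]] := HSC a Ja.
exists v; apply: deriv_on_local Hv => //.
near=> x => Jx.
have xe : `|x - a| < e by rewrite distrC; near: x; apply: nbhsx_ballx.
have ax : linked a x.
  exists h; apply: selectionS Hh => y [Jy ayx]; split=> //=.
  apply: le_lt_trans xe.
  move: ayx; rewrite /between /=; have [ax|xa] := leP a x => /andP[y1 y2].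
    by rewrite !ger0_norm ?subr_ge0 // lerD2r.
  by rewrite !ler0_norm ?subr_le0 ?(ltW xa) // !opprB lerD2l lerN2.
split=> //; rewrite /g; suff -> : linked_class x = linked_class a by [].
apply/seteqP; split=> y [Jy ly]; split=> //.
  exact: linked_trans ax ly.
exact: linked_trans (linkedC ax) ly.
Unshelve. all: by end_near. Qed.

End Classes.
End Patching.

(** * Splitting into two functions with fewer points *)

Section Splitting.
Context (R : realType) (V : normedModType R).
Implicit Types (a b c d x : R) (J K : set R) (f : R -> seq V) (q : nat).
Implicit Types (As Bs : seq (V * V)) (p : V * V).

Lemma selection_cat q1 q2 g1 g2 f f1 f2 K :
  (forall x, K x -> perm_eq (f x) (f1 x ++ f2 x)) ->
  selection q1 g1 f1 K -> selection q2 g2 f2 K ->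
  exists g, selection (q1 + q2) g f K.
Proof.
move=> ff [H1 H1'] [H2 H2'].
exists (fun i => if (i < q1)%N then g1 i else g2 (i - q1)%N).
split=> [x Kx|i iq a Ka].
  apply: perm_trans (ff x Kx) _.
  suff -> : mkseq (fun i => (if (i < q1)%N then g1 i else g2 (i - q1)%N) x)
      (q1 + q2) = mkseq (g1^~ x) q1 ++ mkseq (g2^~ x) q2.
    by apply: perm_cat; [apply: H1|apply: H2].
  rewrite /mkseq iotaD map_cat add0n; congr (_ ++ _).
    by apply/eq_in_map => i; rewrite mem_iota /= add0n => ->.
  have -> : iota q1 q2 = map (addn q1) (iota 0 q2) by rewrite -iotaDl addn0.
  rewrite -map_comp; apply: eq_map => i /=.
  by rewrite ltnNge leq_addr /= addKn.
case: ltnP => iq1; first exact: H1'.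
by apply: H2' => //; rewrite ltn_subLR.
Qed.

(** A fine enough matching pairs the points satisfying [P x] exactly with the maps satisfying [Q],
    so it restricts to them; at [x = b], where [P] need not describe [f1], the matching comes from
    [f1 b] directly. *)
Lemma affine_approx_filter J f f1 b Bs (P : R -> pred V) (Q : pred (V * V)) d :
  0 < d -> perm_eq (f1 b) (unzip1 [seq p <- Bs | Q p]) ->
  (\forall x \near b, J x -> x != b -> f1 x = [seq z <- f x | P x z]) ->
  (\forall x \near b, J x -> x != b -> forall z p, z \in f x -> p \in Bs ->
    `|z - aff p b x| <= d * `|x - b| -> P x z = Q p) ->
  affine_approx J f b Bs -> affine_approx J f1 b [seq p <- Bs | Q p].
Proof.
move=> d0 f1b f1P PQ HB e e0.
(* [e] is the accuracy demanded, [d] the one at which [P] and [Q] agree on matched pairs. *)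
have m0 : 0 < Num.min e d by rewrite lt_min e0.
apply: filterS3 f1P PQ (HB _ m0) => x f1P PQ Hx Jx.
have [->|xb] := eqVneq x b; first exact: base_matched.
have [w [w1 w2 Hw]] := Hx Jx.
have eqw : [seq zp <- w | P x zp.1] = [seq zp <- w | Q zp.2].
  apply: eq_in_filter => zp zpw /=.
  have [zf pB] : zp.1 \in f x /\ zp.2 \in Bs.
    by rewrite -(perm_mem w1) -(perm_mem w2) !map_f.
  apply: (PQ Jx xb _ _ zf pB); apply: le_trans (Hw _ zpw) _.
  by rewrite ler_wpM2r // ge_min lexx orbT.
exists [seq zp <- w | P x zp.1]; split.
- by rewrite /unzip1 -filter_map (f1P Jx xb) perm_filter.
- by rewrite eqw /unzip2 -filter_map perm_filter.
- move=> zp; rewrite mem_filter => /andP[_ /Hw] /le_trans; apply.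
  by rewrite ler_wpM2r // ge_min lexx.
Qed.

Lemma seq_bounded_above (W : eqType) (F : W -> R) (s : seq W) :
  exists2 N, 0 <= N & forall y, y \in s -> F y <= N.
Proof.
elim: s => [|y s [N N0 IH]]; first by exists 0.
exists (Num.max N (F y)); first by rewrite le_max N0.
move=> z; rewrite in_cons le_max => /orP[/eqP ->|/IH ->//].
by rewrite lexx orbT.
Qed.

Section ConeSplit.
Variables (f : R -> seq V) (J : set R) (a : R) (As : seq (V * V)) (p0 : V * V).
Variables (c d : R).
Hypotheses (c0 : 0 < c) (Ja : J a).
Hypothesis HA : affine_approx J f a As.
Hypothesis Hmatch : forall x, `|x - a| < d -> J x -> matched (f x) As a x (c / 2).
Hypothesis Hgap : forall x, `|x - a| < d -> x != a -> forall p, p \in As ->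
  `|aff p a x - aff p0 a x| <= 2 * c * `|x - a| -> p = p0.

Let O : set R := J `&` [set x | `|x - a| < d].
Let P x : pred V := fun z => `|z - aff p0 a x| <= c * `|x - a|.

Let c_half : c / 2 <= c.
Proof. by have := c0; lra. Qed.

(** A map whose cone of aperture [c] meets that of [p0] is within [2 * c * |x - a|] of [p0], which
    [Hgap] allows for [p0] only. *)
Let coneE x z p : O x -> x != a -> p \in As ->
  `|z - aff p a x| <= c * `|x - a| -> P x z = (p == p0).
Proof.
move=> [Jx xd] xa pA zp; apply/idP/eqP => [Pz|pp0]; last by rewrite pp0 in zp.
apply: (Hgap xd xa pA).
have -> : aff p a x - aff p0 a x = (z - aff p0 a x) - (z - aff p a x).
  by rewrite opprB [RHS]addrC subrKA.
by rewrite (le_trans (ler_normB _ _)) //; move: Pz; rewrite /P; lra.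
Qed.

(** The matching has accuracy [c / 2], so a point in the cone of aperture [c] already lies in the
    half cone. This margin prevents points from crossing the boundary of the cone as [x] moves. *)
Let cone_half x z : O x -> x != a -> z \in f x -> P x z ->
  `|z - aff p0 a x| <= c / 2 * `|x - a|.
Proof.
move=> Ox xa zf Pz; have [Jx xd] := Ox; have [w [w1 w2 Hw]] := Hmatch xd Jx.
move: zf; rewrite -(perm_mem w1) => /mapP[zp zpw zE].
have zpA : zp.2 \in As by rewrite -(perm_mem w2) map_f.
have := Hw _ zpw; rewrite -zE => zle.
have : zp.2 == p0.
  rewrite -(coneE Ox xa zpA _ : P x z = _) //.
  by apply: le_trans zle _; rewrite ler_wpM2r.
by move=> /eqP <-.
Qed.

(** At [x = a] the cone shrinks to a point and cannot separate maps with the same value there, so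
    the maps are sorted instead of the points. *)
Definition cone_part (t : bool) x : seq V :=
  if x == a then unzip1 [seq p <- As | (p == p0) == t]
  else [seq z <- f x | P x z == t].

Lemma cone_part_size t x : O x ->
  size (cone_part t x) = count (fun p => (p == p0) == t) As.
Proof.
move=> Ox; have [Jx xd] := Ox; rewrite /cone_part; have [_|xa] := eqVneq x a.
  by rewrite size_map size_filter.
have [w [w1 w2 Hw]] := Hmatch xd Jx.
rewrite size_filter -(seq.permP w1) -(seq.permP w2) !count_map.
apply: eq_in_count => zp zpw /=; congr (_ == _).
apply: coneE => //; first by rewrite -(perm_mem w2) map_f.
by apply: le_trans (Hw _ zpw) _; rewrite ler_wpM2r.
Qed.

Lemma cone_part_cat x : O x ->
  perm_eq (f x) (cone_part true x ++ cone_part false x).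
Proof.
move=> Ox; rewrite /cone_part; have [->|xa] := eqVneq x a.
  apply: perm_trans (affine_approx_base Ja HA) _.
  rewrite /unzip1 -map_cat perm_map // perm_sym.
  have -> : [seq p <- As | (p == p0) == false] =
      [seq p <- As | predC (fun p => (p == p0) == true) p].
    by apply: eq_filter => p /=; case: (p == p0).
  by rewrite perm_filterC.
have -> : [seq z <- f x | P x z == false] =
    [seq z <- f x | predC (fun z => P x z == true) z].
  by apply: eq_filter => z /=; case: (P x z).
by rewrite perm_sym perm_filterC.
Qed.

(** At [a] the maps of [As] are sorted by [coneE]. At [b != a] a map of [Bs] follows its value at
    [b], since the margin of [cone_half] keeps nearby points on the same side. *)
Lemma cone_part_approx t b : O b ->
  (exists Bs, affine_approx J f b Bs) ->
  exists Bs, affine_approx O (cone_part t) b Bs.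
Proof.
move=> Ob [Bs HB]; have [Jb bd] := Ob.
have OJ : O `<=` J by move=> x [].
have [ba|ba] := eqVneq b a.
  exists [seq p <- As | (p == p0) == t]; rewrite ba.
  apply: (@affine_approx_filter O f (cone_part t) a As
    (fun x z => P x z == t) (fun p => (p == p0) == t) c) => //.
  - by rewrite /cone_part eqxx.
  - by near=> x => _ xa; rewrite /cone_part (negbTE xa).
  - near=> x => Ox xa z p zf pA zp; congr (_ == _).
    exact: coneE pA zp.
  - exact: affine_approxS HA.
exists [seq p <- Bs | P b p.1 == t].
have [N N0 HN] := seq_bounded_above (fun p => `|p.2 - p0.2|) Bs.
have ba0 : 0 < `|b - a| by rewrite normr_gt0 subr_eq0.
(* [1 + N] bounds the motion of a point relative to the graph of [p0] per unit of [|x - b|]; the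
   term [c] pays for the change in width of the cone, and [c / 2] in [near_b] is the margin. *)
set K := 1 + N + c; have K0 : 0 < K by rewrite /K; have := c0; lra.
have near_b : \forall x \near b, K * `|x - b| < c / 2 * `|b - a|.
  near=> x; rewrite mulrC -ltr_pdivlMr // distrC; near: x; apply: nbhsx_ballx.
  by rewrite divr_gt0 // mulr_gt0 // divr_gt0.
have xaP x : K * `|x - b| < c / 2 * `|b - a| -> x != a.
  apply: contraPneq => ->; rewrite (distrC a) => lt.
  have : c * `|b - a| <= K * `|b - a| by rewrite ler_wpM2r // /K; lra.
  have : 0 < c * `|b - a| by rewrite mulr_gt0.
  by lra.
apply: (@affine_approx_filter O f (cone_part t) b Bs
    (fun x z => P x z == t) (fun p => P b p.1 == t) 1) => //.
- rewrite /cone_part (negbTE ba).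
  have -> : unzip1 [seq p <- Bs | P b p.1 == t] =
      [seq z <- unzip1 Bs | P b z == t] by rewrite filter_map.
  apply: perm_filter; exact: affine_approx_base HB.
- by apply: filterS near_b => x /xaP xa _ _; rewrite /cone_part (negbTE xa).
- apply: filterS near_b => x xK Ox _ z p zf pB; rewrite mul1r => zp.
  have xa := xaP _ xK; congr (_ == _).
  have pf : p.1 \in f b by rewrite (perm_mem (affine_approx_base Jb HB)) map_f.
  have move_le : `|(z - aff p0 a x) - (p.1 - aff p0 a b)| <= (1 + N) * `|x - b|.
    have -> : (z - aff p0 a x) - (p.1 - aff p0 a b) =
        (z - aff p b x) + (x - b) *: (p.2 - p0.2).
      have -> : aff p0 a x = aff p0 a b + (x - b) *: p0.2.
        by rewrite /aff -addrA -scalerDl; congr (_ + _ *: _); lra.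
      rewrite {3}/aff scalerBr.
      move: ((x - b) *: p.2) ((x - b) *: p0.2) (aff p0 a b) => A B q0.
      have -> : z - (p.1 + A) + (A - B) = z - p.1 - B.
        by rewrite opprD !addrA subrK.
      by rewrite opprB [q0 + B]addrC opprD !addrA subrK addrAC.
    apply: le_trans (ler_normD _ _) _; rewrite normrZ mulrDl mul1r lerD //.
    by rewrite mulrC ler_wpM2r // HN.
  have xab : `|b - a| <= `|x - a| + `|x - b|.
    by rewrite (distrC x b) [leRHS]addrC ler_distD.
  have xba : `|x - a| <= `|x - b| + `|b - a| by rewrite ler_distD.
  have cxb : c * `|b - a| <= c * `|x - a| + c * `|x - b|.
    by rewrite -mulrDr ler_wpM2l // ltW.
  have cxa : c * `|x - a| <= c * `|x - b| + c * `|b - a|.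
    by rewrite -mulrDr ler_wpM2l // ltW.
  have cb0 : 0 <= c * `|x - b| by rewrite mulr_ge0 // ltW.
  have N0' : 0 <= N * `|x - b| by rewrite mulr_ge0.
  have b0 : 0 <= `|x - b| by [].
  move: xK; rewrite /K !mulrDl mul1r => xK.
  rewrite mulrDl mul1r in move_le.
  apply/idP/idP.
    move=> /(cone_half Ox xa zf) h; rewrite /P.
    have := ler_normB (z - aff p0 a x) ((z - aff p0 a x) - (p.1 - aff p0 a b)).
    by rewrite subKr; lra.
  move=> /(cone_half Ob ba pf) h; rewrite /P.
  have := ler_normD ((z - aff p0 a x) - (p.1 - aff p0 a b)) (p.1 - aff p0 a b).
  by rewrite subrK; lra.
- exact: affine_approxS HB.
Unshelve. all: by end_near. Qed.

End ConeSplit.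
End Splitting.

(** * Induction on the number of points *)

Section Existence.

Lemma selection_exists (R : realType) (V : normedModType R) (q : nat)
    (f : R -> seq V) (J : set R) : is_interval J ->
  (forall c, J c -> exists As, affine_approx J f c As) ->
  (forall c, J c -> size (f c) = q) ->
  exists g, selection q g f J.
Proof.
elim/ltn_ind: q f J => q IH f J iJ HA Hsz.
apply: selection_patch => // a Ja; have [As HAs] := HA a Ja.
have szA : size As = q.
  by rewrite -(Hsz a Ja) (perm_size (affine_approx_base Ja HAs)) size_map.
(* The default of [head] occurs only for empty [As], where [all] holds and [q = 0]. *)
case: (boolP (all (pred1 (head 0 As)) As)) => [/all_pred1P|].
  by rewrite szA => eA; left; exists (head 0 As); rewrite -eA.
set p0 := head 0 As => nconst; right.
have p0A : p0 \in As.
  by move: nconst; rewrite /p0; case: (As) => //= *; exact: mem_head.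
have [c' c'0 Hc'] := aff_inj_seq2 As [:: p0] a.
(* Half of the gap constant, so that cones of aperture [c] around [p0] and around another map stay
   disjoint. *)
set c := c' / 2; have c0 : 0 < c by rewrite divr_gt0.
have c20 : 0 < c / 2 by rewrite divr_gt0.
have [/= d d0 Hd] := filterI (HAs _ c20) Hc'.
have ball_a x : `|x - a| < d -> ball_ Num.norm a d x by rewrite /= distrC.
have Hmatch x : `|x - a| < d -> J x -> matched (f x) As a x (c / 2).
  by move=> /ball_a/Hd[].
have Hgap x : `|x - a| < d -> x != a -> forall p, p \in As ->
    `|aff p a x - aff p0 a x| <= 2 * c * `|x - a| -> p = p0.
  move=> /ball_a/Hd[_ +] xa p pA => /(_ xa p p0 pA); rewrite mem_head => /(_ isT).
  by rewrite /c mulrCA divff ?mulr1 // pnatr_eq0.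
set O := J `&` [set x | `|x - a| < d].
have iO : is_interval O.
  apply: is_intervalI => // x y /= xd yd z /andP[xz zy].
  move: xd yd; rewrite !ltr_norml => /andP[x1 _] /andP[_ y2].
  by apply/andP; split; lra.
pose m (t : bool) := count (fun p => (p == p0) == t) As.
have mq : (m true + m false)%N = q.
  rewrite -szA -(count_predC (fun p => (p == p0) == true)); congr (_ + _)%N.
  by apply: eq_count => p /=; case: (p == p0).
(* Both parts are nonempty, so each has fewer than [q] points and the induction applies. *)
have m0 t : (0 < m t)%N.
  rewrite /m -has_count; apply/hasP; case: t; first by exists p0; rewrite ?eqxx.
  by move: nconst => /allPn[p pA /= pp0]; exists p => //; rewrite eqbF_neg.
have lt_add (k l : nat) : (0 < l)%N -> (k < k + l)%N.
  by move=> l0; rewrite -[X in (X < _)%N]addn0 ltn_add2l.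
have Hpart t : exists g, selection (m t) g (cone_part f a As p0 c t) O.
  apply: IH => //.
  - rewrite -mq; case: (t); first exact: lt_add.
    by rewrite addnC; exact: lt_add.
  - move=> b Ob; have [Jb _] := Ob.
    exact: (cone_part_approx c0 HAs Hmatch Hgap _ Ob (HA b Jb)).
  - by move=> b Ob; apply: (cone_part_size c0 Hmatch Hgap).
exists d => //; rewrite -mq.
have [g1 Hg1] := Hpart true; have [g2 Hg2] := Hpart false.
apply: selection_cat Hg1 Hg2 => x Ox.
exact: (cone_part_cat p0 c Ja HAs Ox).
Qed.

End Existence.

(** * From measures and the Euclidean metric to multisets and the sup norm *)

Section Transfer.
Context (R : realType) (n q : nat).

Lemma norm_le_eucl_norm (v : 'rV[R]_n) : `|v| <= eucl_norm v.
Proof.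
rewrite /Num.norm /= mx_normrE; apply: bigmax_le => [|[i j] _ /=].
  exact: sqrtr_ge0.
rewrite (ord1 i) -sqrtr_sqr ler_wsqrtr // (bigD1 j) //= lerDl.
by apply: sumr_ge0 => k _; exact: sqr_ge0.
Qed.

Lemma perm_codom_perm (T : eqType) (y : 'I_q -> T) (s : 'S_q) :
  perm_eq (codom (y \o s)) (codom y).
Proof.
rewrite codomE map_comp perm_map //.
apply: uniq_perm => [||b]; [|exact: enum_uniq|].
  by rewrite (map_inj_uniq (@perm_inj _ s)) enum_uniq.
rewrite mem_enum; apply/mapP; exists ((s^-1)%g b).
  by rewrite mem_enum.
by rewrite permKV.
Qed.

Lemma Qsum_perm_eqP (y z : 'I_q -> 'rV[R]_n) :
  Qsum y = Qsum z <-> perm_eq (codom y) (codom z).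
Proof.
split=> [/Qsum_eqP[s ys]|].
  by rewrite (eq_codom (g := z \o s)) // perm_codom_perm.
have codomT (u : 'I_q -> 'rV[R]_n) : codom u = [tuple u i | i < q] :> seq _ by [].
rewrite !codomT => /tuple_permP[s ts]; apply/Qsum_eqP; exists s => a.
have /(congr1 (fun t => nth 0 t a)) := ts.
by rewrite -!tnth_nth !tnth_mktuple.
Qed.

(** An optimal permutation gives the matching, each of its terms being at most the total cost. *)
Lemma affine_approx_Qpoints (I : interval R) (f : R -> Qq R n q) (a : R) :
  affinely_approximable_at I f a ->
  exists As, affine_approx [set` I] (fun x => codom (Qpoints (f x))) a As.
Proof.
move=> [A [/choice[u /choice[v uv]] fa cvA]].
have AE b x : aff (A b a, v b) a x = A b x.
  by rewrite /aff /= !uv scalerBl addrCA addrAC subrK addrC.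
exists (codom (fun b => (A b a, v b))) => e e0.
have /cvgrPdist_le/(_ e e0) := cvA.
rewrite !near_withinE => near_a; apply: filterS near_a => x Hx Ix.
(* The punctured limit says nothing at [a]; there the clause on [f a] gives an exact matching. *)
have [->|xa] := eqVneq x a.
  apply: base_matched; rewrite /unzip1 -map_comp.
  by apply/Qsum_perm_eqP; rewrite QpointsK fa.
have := Hx xa Ix; set y := Qpoints (f x).
rewrite -(QpointsK (f x)) distQ_Qsum -/y.
have [s ->] := min_match_cost_ex y (fun b => A b x) => cost_le.
exists (codom (fun b => (y b, (A (s b) a, v (s b))))); split.
- by rewrite /unzip1 -map_comp.
- rewrite /unzip2 -map_comp.
  exact: (perm_codom_perm (fun b => (A b a, v b)) s).
move=> _ /mapP[b _ ->] /=; rewrite AE.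
apply: le_trans (norm_le_eucl_norm _) _.
apply: (@le_trans _ _ (match_cost y (fun b => A b x) s)).
  rewrite /match_cost (bigD1 b) //= lerDl sumr_ge0 // => i _.
  exact: sqrtr_ge0.
have xa0 : 0 < `|x - a| by rewrite normr_gt0 subr_eq0.
rewrite -ler_pdivrMr // mulrC; apply: le_trans cost_le.
by rewrite sub0r normrN ler_norm.
Qed.

Lemma deriv_on_differentiable (I : interval R) (g : R -> 'rV[R]_n) :
  (forall a, a \in I -> exists v, deriv_on [set` I] g a v) ->
  differentiable_on I g.
Proof.
move=> H a aI; have [v Hv] := H a aI; apply/cvg_ex; exists v.
apply/cvgrPdist_le => e e0; rewrite !near_withinE.
apply: filterS (Hv e e0) => x Hx xa Ix.
have xa0 : x - a != 0 by rewrite subr_eq0.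
have -> : v - (x - a)^-1 *: (g x - g a) =
    - ((x - a)^-1 *: (g x - aff (g a, v) a x)).
  by rewrite /aff /= opprD addrA [in RHS]scalerBr scalerA mulVf // scale1r opprB.
rewrite normrN normrZ normfV ler_pdivrMl ?normr_gt0 // mulrC.
exact: Hx.
Qed.

End Transfer.

End MultivaluedFunctions.

Theorem theorem4p15 (R : realType) (n q : nat) (n_gt0 : (0 < n)%N)
    (q_gt0 : (0 < q)%N) (I : interval R) (I_int : [set` I]° !=set0)
    (f : R -> Qq R n q) :
  affinely_approximable I f ->
  exists g : 'I_q -> R -> 'rV[R]_n,
    (forall b : 'I_q, differentiable_on I (g b)) /\
    (forall x : R, x \in I -> f x = Qsum (fun b : 'I_q => g b x)).
Proof.
move=> Hf.
have [| |c _|g [fg dg]] := @selection_exists R _ q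
    (fun x => codom (Qpoints (f x))) [set` I].
- exact: interval_is_interval.
- by move=> c /= /Hf; apply: affine_approx_Qpoints.
- by rewrite size_codom card_ord.
exists (fun b => g b); split=> [b|x xI].
  by apply: deriv_on_differentiable => a aI; apply: dg.
rewrite -[LHS]QpointsK; apply/Qsum_perm_eqP.
rewrite (permPl (fg x xI)) /mkseq -val_enum_ord -map_comp.
exact: perm_refl.
Qed.
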